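(* Let $D=\operatorname{diag}(d_r,d_s,d_t)$ with $d_r,d_s,d_t>0$. For any $v_0=(r_0,s_0,t_0)\in\mathbb{R}^3$, the corresponding $v_p,v_d\in\mathbb{R}^3$ that satisfy $$v_0=v_p+v_d,\quad v_p\in D\mathcal{K}_{\exp},\quad v_d\in -D^{-1}\mathcal{K}_{\exp}^*,\quad \langle v_p,v_d\rangle=0 \qquad (\star)$$ can be computed as follows. 1. If $v_0\in D\mathcal{K}_{\exp}$, then $v_p=v_0$ and $v_d=\mathbf{0}$. 2. If $v_0\in -D^{-1}\mathcal{K}_{\exp}^*$, then $v_p=\mathbf{0}$ and $v_d=v_0$. 3. If $r_0\le 0$ and $s_0\le 0$, then $v_p=(r_0,0,t_0^+)$ and $v_d=(0,s_0,-t_0^-)$. 4. Otherwise, solve the root-finding problem $$h(\rho):=d_t e^{\rho}s_p(\rho)-d_t^{-1}e^{-\rho}r_d(\rho)-t_0=0,$$ where $$s_p(\rho)=\frac{s_0d_r^{-2}d_s-d_r^{-1}r_0(1-\rho)}{d_s^2d_r^{-2}+\rho(\rho-1)},\qquad r_d(\rho)=\frac{d_s^2d_r^{-1}\left(r_0-d_s^{-1}d_r\,\rho\, s_0\right)}{d_s^2d_r^{-2}+\rho(\rho-1)},$$ for $\rho$ in the interval $(l_\rho,u_\rho)$, where $$(l_\rho,u_\rho)=\begin{cases}(\min\{a_3,a_4\},\max\{a_3,a_4\}), & r_0>0,\ s_0>0,\\ (-\infty,a_3), & r_0\le 0,\ s_0>0,\\ (a_4,+\infty), & r_0>0,\ s_0\le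 0,\end{cases}$$ and $$a_3=\frac{r_0d_s}{s_0d_r},\qquad a_4=1-\frac{s_0d_s}{r_0d_r}.$$ Then the solution $(v_p,v_d)$ of $(\star)$ is given by $$v_p=\big(d_r\rho,\ d_s,\ d_te^{\rho}\big)\,s_p(\rho),\qquad v_d=\big(d_r^{-1},\ (1-\rho)d_s^{-1},\ -d_t^{-1}e^{-\rho}\big)\,r_d(\rho).$$
   Context: The exponential cone is $\mathcal{K}_{\exp}=\{(r,s,t)\in\mathbb{R}^3: s>0,\ t\ge s\exp(r/s)\}\cup\{(r,s,t)\in\mathbb{R}^3: s=0,\ t\ge 0,\ r\le 0\}$, and its dual cone is $\mathcal{K}_{\exp}^*=\{(r,s,t)\in\mathbb{R}^3: r<0,\ e\cdot t\ge -r\exp(s/r)\}\cup\{(r,s,t)\in\mathbb{R}^3: r=0,\ s\ge 0,\ t\ge 0\}$, where $e=\exp(1)$. For a positive diagonal matrix $D$ and a cone $\mathcal{K}$, $D\mathcal{K}=\{Dv:v\in\mathcal{K}\}$, and $-D^{-1}\mathcal{K}=\{-D^{-1}v: v\in\mathcal{K}\}$. For real $x$, $x^+=\max\{x,0\}$ and $x^-=-\min\{x,0\}$. By Moreau's decomposition theorem, the system $(\star)$ has a unique solution: $v_p$ is the Euclidean projection of $v_0$ onto $D\mathcal{K}_{\exp}$ and $v_d$ is the Euclidean projection of $v_0$ onto $-D^{-1}\mathcal{K}_{\exp}^*$. ''Otherwise'' in case 4 means that none of the hypotheses of cases 1, 2, 3 holds; $a_3$ is used only when $s_0>0$ and $a_4$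 only when $r_0>0$.
   Formalization: In case 4 a root of h is asserted to exist only when the interval (l_ρ,u_ρ) is nonempty; it is empty when r_0,s_0>0 and a_3=a_4 (e.g. d_r=2, d_s=d_t=1, v_0=(1,1,0)), where no root can exist. *)

(* Defs.v *)
From HB Require Import structures.
From mathcomp Require Import all_boot all_order all_algebra.
From mathcomp Require Import all_classical all_reals all_analysis.

Set Implicit Arguments.
Unset Strict Implicit.
Unset Printing Implicit Defensive.

Import Order.TTheory GRing.Theory Num.Theory.

Local Open Scope classical_set_scope.
Local Open Scope ring_scope.

Definition vec3 (R : realType) (r s t : R) : 'cV[R]_3 :=
  \col_(i < 3) [:: r; s; t]`_i.

Definition dotv (R : realType) (u v : 'cV[R]_3) : R :=
  \sum_(i < 3) u i 0 * v i 0.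

Definition posr (R : realType) (x : R) : R := Num.max x 0.

Definition negr (R : realType) (x : R) : R := - Num.min x 0.

Definition exp_cone (R : realType) : set 'cV[R]_3 :=
  [set v | let r := v 0 0 in let s := v 1 0 in let t := v 2 0 in
           0 < s /\ t >= s * expR (r / s)] `|`
  [set v | let r := v 0 0 in let s := v 1 0 in let t := v 2 0 in
           [/\ s = 0, t >= 0 & r <= 0]].

Definition exp_cone_dual (R : realType) : set 'cV[R]_3 :=
  [set v | let r := v 0 0 in let s := v 1 0 in let t := v 2 0 in
           r < 0 /\ expR 1 * t >= - r * expR (s / r)] `|`
  [set v | let r := v 0 0 in let s := v 1 0 in let t := v 2 0 in
           [/\ r = 0, s >= 0 & t >= 0]].

Definition scaling (R : realType) (dr ds dt : R) : 'M[R]_3 :=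
  diag_mx (vec3 dr ds dt)^T.

Definition scaled_exp_cone (R : realType) (dr ds dt : R) : set 'cV[R]_3 :=
  [set scaling dr ds dt *m v | v in @exp_cone R].

Definition scaled_exp_polar (R : realType) (dr ds dt : R) : set 'cV[R]_3 :=
  [set - (invmx (scaling dr ds dt) *m v) | v in @exp_cone_dual R].

Definition moreau_system (R : realType) (dr ds dt : R)
    (v0 vp vd : 'cV[R]_3) : Prop :=
  [/\ v0 = vp + vd,
      scaled_exp_cone dr ds dt vp,
      scaled_exp_polar dr ds dt vd
    & dotv vp vd = 0].

(* In the root-finding regime the denominator below does not vanish on
   [root_itv], although it may vanish elsewhere when [ds / dr <= 1 / 2]. *)
Definition s_p (R : realType) (dr ds r0 s0 rho : R) : R :=
  (s0 * dr ^- 2 * ds - dr^-1 * r0 * (1 - rho))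
    / (ds ^+ 2 * dr ^- 2 + rho * (rho - 1)).

Definition r_d (R : realType) (dr ds r0 s0 rho : R) : R :=
  (ds ^+ 2 * dr^-1 * (r0 - ds^-1 * dr * rho * s0))
    / (ds ^+ 2 * dr ^- 2 + rho * (rho - 1)).

Definition root_fun (R : realType) (dr ds dt r0 s0 t0 rho : R) : R :=
  dt * expR rho * s_p dr ds r0 s0 rho
    - dt^-1 * expR (- rho) * r_d dr ds r0 s0 rho - t0.

Definition a3 (R : realType) (dr ds r0 s0 : R) : R := (r0 * ds) / (s0 * dr).

Definition a4 (R : realType) (dr ds r0 s0 : R) : R :=
  1 - (s0 * ds) / (r0 * dr).

(* The last branch is only meant for [0 < r0] and [s0 <= 0].
   The first interval is empty exactly when [a3] and [a4] coincide, i.e. when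
   [ds * (r0 ^+ 2 + s0 ^+ 2) = dr * (r0 * s0)]. *)
Definition root_itv (R : realType) (dr ds r0 s0 : R) : interval R :=
  let b3 := a3 dr ds r0 s0 in
  let b4 := a4 dr ds r0 s0 in
  if (0 < r0) && (0 < s0) then `]Num.min b3 b4, Num.max b3 b4[
  else if (r0 <= 0) && (0 < s0) then `]-oo, b3[
  else `]b4, +oo[.

(* Main.v *)
Require Import Defs.
From HB Require Import structures.
From mathcomp Require Import all_boot all_order all_algebra.
From mathcomp Require Import all_classical all_reals all_analysis.
From mathcomp Require Import ring lra.

(* Uniqueness in the system is Moreau's argument; existence is obtained by
   exhibiting the solution. The two boundary rays indexed by rho are orthogonal,
   and matching the first two coordinates of v0 with a combination of them is a
   2 x 2 linear system whose solution is (s_p, r_d). If r0, s0 > 0, the numerators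
   are positive multiples of rho - a4 and a3 - rho, and between these two points
   the common denominator has the sign of a3 - a4, so that s_p and r_d are
   positive; in the other cases the denominator is positive on the interval. At
   a3 one has r_d = 0, so h(a3) > 0 says that v0 is not in the scaled cone; at a4
   one has s_p = 0, so h(a4) < 0 says that v0 is not in the scaled polar cone. The
   intermediate value theorem then gives the root, an infinite endpoint being
   handled by the growth of the exponential. *)

Set Implicit Arguments.
Unset Strict Implicit.
Unset Printing Implicit Defensive.

Import Order.TTheory GRing.Theory Num.Theory.
Import numFieldNormedType.Exports.

Local Open Scope classical_set_scope.
Local Open Scope ring_scope.

(** * Coordinates, and the pairing of the exponential cone with its dual *)

Section Coordinates.
Variable R : realType.
Implicit Types (r s t : R) (u v : 'cV[R]_3).

Lemma vec3K v : v = vec3 (v 0 0) (v 1 0) (v 2 0).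
Proof.
apply/matrixP=> i j; rewrite ord1 mxE.
by case: i => [[|[|[|//]]] hi] /=; congr (v _ _); apply: val_inj.
Qed.

Lemma vec3E r s t : (vec3 r s t 0 0 = r) * (vec3 r s t 1 0 = s) * (vec3 r s t 2 0 = t).
Proof. by rewrite !mxE. Qed.

Lemma vec3_inj r s t r' s' t' :
  vec3 r s t = vec3 r' s' t' -> [/\ r = r', s = s' & t = t'].
Proof.
move=> e; have := (congr1 (fun v => v 0 0) e, congr1 (fun v => v 1 0) e,
  congr1 (fun v => v 2 0) e).
by rewrite /= !vec3E => -[[]].
Qed.

Lemma vec3D r s t r' s' t' :
  vec3 r s t + vec3 r' s' t' = vec3 (r + r') (s + s') (t + t').
Proof. by rewrite [LHS]vec3K !mxE. Qed.

Lemma vec3Z a r s t : a *: vec3 r s t = vec3 (a * r) (a * s) (a * t).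
Proof. by rewrite [LHS]vec3K !mxE. Qed.

Lemma vec30 : vec3 0 0 0 = 0 :> 'cV[R]_3.
Proof. by rewrite [RHS]vec3K !mxE. Qed.

Lemma dotv_vec3 r s t r' s' t' :
  dotv (vec3 r s t) (vec3 r' s' t') = r * r' + s * s' + t * t'.
Proof.
by rewrite /dotv !big_ord_recr big_ord0 /= !mxE /= add0r.
Qed.

Lemma exp_cone_vec3 r s t : exp_cone (vec3 r s t) <->
  (0 < s /\ s * expR (r / s) <= t) \/ [/\ s = 0, 0 <= t & r <= 0].
Proof. by rewrite /exp_cone /setU /mkset !vec3E. Qed.

Lemma exp_cone_dual_vec3 r s t : exp_cone_dual (vec3 r s t) <->
  (r < 0 /\ - r * expR (s / r) <= expR 1 * t) \/ [/\ r = 0, 0 <= s & 0 <= t].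
Proof. by rewrite /exp_cone_dual /setU /mkset !vec3E. Qed.

(** When both points lie on the main branches, this is [1 + x <= expR x] at
    [x = r / s + (s' / r' - 1)], multiplied by the nonnegative factor [s * - r']: the linear side
    becomes [- (r * r' + s * s')] and the exponential side is bounded by [t * t']. *)
Lemma exp_cone_dual_ge0 u v : exp_cone u -> exp_cone_dual v -> 0 <= dotv u v.
Proof.
rewrite (vec3K u) (vec3K v) dotv_vec3 exp_cone_vec3 exp_cone_dual_vec3.
set r := u 0 0; set s := u 1 0; set t := u 2 0.
set r' := v 0 0; set s' := v 1 0; set t' := v 2 0.
case=> [[s_gt0 tle]|[-> t_ge0 r_le0]]; case=> [[r'_lt0 tle']|[-> s'_ge0 t'_ge0]].
- have e1 := expR_gt0 (1 : R).
  have ers := expR_gt0 (r / s).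
  (* The factor [expR 1] of the dual cone is absorbed into the exponent as [- 1]. *)
  have t'E : - r' * expR (s' / r' - 1) <= t'.
    by rewrite expRD expRN mulrA ler_pdivrMr // [t' * _]mulrC.
  have ele : 1 + (r / s + (s' / r' - 1)) <= expR (r / s) * expR (s' / r' - 1).
    by rewrite -expRD expR_ge1Dx.
  have tt : (s * expR (r / s)) * (- r' * expR (s' / r' - 1)) <= t * t'.
    by apply: ler_pM => //; apply: mulr_ge0; rewrite ?expR_ge0 //; lra.
  have sr' : 0 <= s * - r' by apply: mulr_ge0; lra.
  have := ler_wpM2l sr' ele.
  have -> : s * - r' * (1 + (r / s + (s' / r' - 1))) = - (r * r' + s * s').
    by field; rewrite !(gt_eqF s_gt0, lt_eqF r'_lt0).
  have -> : s * - r' * (expR (r / s) * expR (s' / r' - 1)) =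
    s * expR (r / s) * (- r' * expR (s' / r' - 1)) by ring.
  lra.
- have : 0 <= t by apply: le_trans tle; rewrite mulr_ge0 ?expR_ge0 // ltW.
  by nra.
- have : 0 <= expR 1 * t'.
    by apply: le_trans tle'; rewrite mulr_ge0 ?expR_ge0 //; lra.
  by rewrite pmulr_rge0 ?expR_gt0 //; nra.
- nra.
Qed.

(** * Diagonally scaled cones, polarity and uniqueness of the decomposition *)

Context (dr ds dt : R) (hdr : 0 < dr) (hds : 0 < ds) (hdt : 0 < dt).

Lemma scaling_mul r s t :
  scaling dr ds dt *m vec3 r s t = vec3 (dr * r) (ds * s) (dt * t).
Proof. by rewrite mul_diag_mx [LHS]vec3K !mxE. Qed.

Lemma scaling_unit : scaling dr ds dt \in unitmx.
Proof.
rewrite unitmxE det_diag !big_ord_recr big_ord0 /= !mxE /= mul1r unitfE.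
by rewrite !mulf_neq0 ?gt_eqF.
Qed.

Lemma invmx_scaling_mul r s t :
  invmx (scaling dr ds dt) *m vec3 r s t = vec3 (r / dr) (s / ds) (t / dt).
Proof.
apply: (can_inj (mulKmx scaling_unit)); rewrite mulKVmx ?scaling_unit//.
by rewrite scaling_mul; congr vec3; field; rewrite gt_eqF.
Qed.

Lemma scaled_exp_coneP r s t : scaled_exp_cone dr ds dt (vec3 r s t) <->
  exp_cone (vec3 (r / dr) (s / ds) (t / dt)).
Proof.
rewrite -invmx_scaling_mul; split=> [[v Kv <-]|Kv].
  by rewrite mulKmx ?scaling_unit.
by exists (invmx (scaling dr ds dt) *m vec3 r s t); rewrite ?mulKVmx ?scaling_unit.
Qed.

Lemma scaled_exp_polarP r s t : scaled_exp_polar dr ds dt (vec3 r s t) <->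
  exp_cone_dual (vec3 (- (dr * r)) (- (ds * s)) (- (dt * t))).
Proof.
have -> : vec3 (- (dr * r)) (- (ds * s)) (- (dt * t)) =
    - (scaling dr ds dt *m vec3 r s t).
  by rewrite scaling_mul -[RHS]scaleN1r vec3Z !mulN1r.
split=> [[v Kv <-]|Kv].
  by rewrite mulmxN opprK mulKVmx ?scaling_unit.
by exists (- (scaling dr ds dt *m vec3 r s t)); rewrite // mulmxN opprK mulKmx ?scaling_unit.
Qed.

Lemma scaled_polar_le0 u v :
  scaled_exp_cone dr ds dt u -> scaled_exp_polar dr ds dt v -> dotv u v <= 0.
Proof.
rewrite (vec3K u) (vec3K v) scaled_exp_coneP scaled_exp_polarP.
move=> Ku Kv; have := exp_cone_dual_ge0 Ku Kv; rewrite !dotv_vec3.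
set x := (X in 0 <= X); set y := (X in X <= 0).
suff -> : x = - y by rewrite oppr_ge0.
by rewrite /x /y; field; rewrite !gt_eqF.
Qed.

(* The difference [p - p' = d' - d] has squared norm [<p, d'> + <p', d>], which
   is nonpositive by polarity. *)
Lemma moreau_uniq (v0 p d p' d' : 'cV[R]_3) :
  moreau_system dr ds dt v0 p d -> moreau_system dr ds dt v0 p' d' ->
  p = p' /\ d = d'.
Proof.
move=> [e Kp Kd pd] [e' Kp' Kd' pd'].
have := scaled_polar_le0 Kp Kd'; have := scaled_polar_le0 Kp' Kd.
move: e e' pd pd'; rewrite (vec3K v0) (vec3K p) (vec3K d) (vec3K p') (vec3K d').
rewrite !vec3D !dotv_vec3 => /vec3_inj[e0 e1 e2] /vec3_inj[f0 f1 f2] pd pd' h h'.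
move: e0 e1 e2 f0 f1 f2 pd pd' h h'.
move: (v0 0 0) (v0 1 0) (v0 2 0) (p 0 0) (p 1 0) (p 2 0) (d 0 0) (d 1 0) (d 2 0).
move: (p' 0 0) (p' 1 0) (p' 2 0) (d' 0 0) (d' 1 0) (d' 2 0).
move=> x y z a b c x0 y0 z0 x' y' z' a' b' c' -> -> -> f0 f1 f2 pd pd' h h'.
have n0 : (x' - x) ^+ 2 + ((y' - y) ^+ 2 + (z' - z) ^+ 2) <= 0.
  have aE : a = x' + a' - x by lra.
  have bE : b = y' + b' - y by lra.
  have cE : c = z' + c' - z by lra.
  by subst a b c; nra.
have sx := sqr_ge0 (x' - x); have sy := sqr_ge0 (y' - y).
have sz := sqr_ge0 (z' - z).
have zx : (x' - x) ^+ 2 == 0 by apply/eqP; lra.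
have zy : (y' - y) ^+ 2 == 0 by apply/eqP; lra.
have zz : (z' - z) ^+ 2 == 0 by apply/eqP; lra.
move: zx zy zz; rewrite !sqrf_eq0 !subr_eq0 => /eqP ex /eqP ey /eqP ez.
by split; congr vec3; lra.
Qed.

(* The ray [(rho, 1, e^rho)] of the exponential cone and the ray
   [(-1, rho - 1, e^-rho)] of its dual are orthogonal. *)
Lemma moreau_rays (r0 s0 t0 rho sp rd : R) : 0 < sp -> 0 < rd ->
  r0 = dr * rho * sp + dr^-1 * rd ->
  s0 = ds * sp + (1 - rho) * ds^-1 * rd ->
  t0 = dt * expR rho * sp - dt^-1 * expR (- rho) * rd ->
  moreau_system dr ds dt (vec3 r0 s0 t0) (sp *: vec3 (dr * rho) ds (dt * expR rho))
    (rd *: vec3 dr^-1 ((1 - rho) * ds^-1) (- dt^-1 * expR (- rho))).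
Proof.
move=> sp0 rd0 er es et; rewrite !vec3Z.
have [dr0 ds0 dt0] : [/\ dr != 0, ds != 0 & dt != 0] by rewrite !gt_eqF.
split.
- by rewrite vec3D; congr vec3; rewrite ?er ?es ?et; ring.
- rewrite scaled_exp_coneP exp_cone_vec3; left.
  rewrite mulfK //; split=> //.
  have -> : sp * (dr * rho) / dr / sp = rho by field; rewrite dr0 gt_eqF.
  have -> // : sp * (dt * expR rho) / dt = sp * expR rho by field.
- rewrite scaled_exp_polarP exp_cone_dual_vec3; left.
  have -> : dr * (rd * dr^-1) = rd by field.
  rewrite oppr_lt0; split=> //.
  have -> : - (ds * (rd * ((1 - rho) * ds^-1))) / - rd = 1 - rho.
    by field; rewrite ds0 gt_eqF.
  have -> : - (dt * (rd * (- dt^-1 * expR (- rho)))) = rd * expR (- rho) by field.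
  by rewrite opprK expRD mulrCA.
- have := expRxMexpNx_1 rho; rewrite dotv_vec3 => eE.
  have -> : sp * (dt * expR rho) * (rd * (- dt^-1 * expR (- rho))) =
      - (sp * rd * (expR rho * expR (- rho))) by field.
  by rewrite eE; field; rewrite dr0 ds0.
Qed.

End Coordinates.

(** * Strict intermediate values and exponential growth *)

Section RealFunctions.
Variable R : realType.

(** The endpoints are unordered because [a3] and [a4] may come in either order; the root is interior
    since [f] is nonzero at both of them. *)
Lemma IVT_strict (f : R -> R) (a b : R) :
  (forall x, Num.min a b <= x <= Num.max a b -> {for x, continuous f}) ->
  f a < 0 -> 0 < f b ->
  exists2 x, Num.min a b < x < Num.max a b & f x = 0.
Proof.
move=> fc fa fb.
have le_mM : Num.min a b <= Num.max a b by rewrite ge_min le_max lexx.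
have [||x] := @IVT R f _ _ 0 le_mM.
- apply: continuous_in_subspaceT => x.
  by rewrite inE /= in_itv /=; apply: fc.
- by case: (leP a b) => _; rewrite ge_min le_max (ltW fa) (ltW fb) ?orbT.
rewrite in_itv /= => /andP[mx xM] fx0; exists x => //.
have xa : x != a by apply: contraTneq fa => <-; rewrite fx0 ltxx.
have xb : x != b by apply: contraTneq fb => <-; rewrite fx0 ltxx.
by move: mx xM; case: (leP a b) => _ mx xM;
  rewrite !lt_neqAle mx xM ![_ == x]eq_sym xa xb.
Qed.

(** Serves both infinite endpoints: [sigma = -1] for [+oo], and [sigma = 1] for [-oo] after the
    substitution of [- x] for [x]. *)
Lemma expR_dominates (c sigma A B P Q T m : R) :
  0 < c -> -1 <= sigma <= 1 -> 0 < A -> 0 <= P -> 0 <= Q ->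
  exists2 x, m < x &
    0 < expR x * ((A * x - B) / (c + x * (x + sigma)))
        - expR (- x) * ((P + Q * x) / (c + x * (x + sigma))) - T.
Proof.
move=> c0 /andP[sm1 s1] A0 P0 Q0.
have [m0 B0 T0] : [/\ m <= `|m|, B <= `|B| & T <= `|T|] by rewrite !ler_norm.
have [m1 B1 T1] : [/\ 0 <= `|m|, 0 <= `|B| & 0 <= `|T|] by rewrite !normr_ge0.
(* For [x >= 1] the denominator is at most [(c + 2) * x ^+ 2], so [C * x ^+ 2] bounds all the terms
   to be beaten. *)
pose C := `|T| * (c + 2) + P + Q.
have C0 : 0 <= C by rewrite /C; nra.
(* The four summands give in turn [x >= 1], [x > m], [A * x >= 2 * |B|] (hence
   [A * x - B >= A * x / 2]) and [A * x > 8 * C]; the factor 8 matches the bound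
   [x ^+ 2 / 4 * (A * x / 2)] below. *)
pose x := 1 + `|m| + 2 * `|B| / A + 8 * C / A.
have BA0 : 0 <= 2 * `|B| / A by rewrite divr_ge0 ?mulr_ge0// ltW.
have CA0 : 0 <= 8 * C / A by rewrite divr_ge0 ?mulr_ge0// ltW.
have x1 : 1 <= x by rewrite /x; lra.
have AxB : 2 * `|B| <= A * x.
  have : A * (2 * `|B| / A) <= A * x by rewrite ler_pM2l // /x; lra.
  by rewrite mulrC divfK // gt_eqF.
have AxC : 8 * C < A * x.
  have : A * (8 * C / A) < A * x by rewrite ltr_pM2l // /x; lra.
  by rewrite [A * _]mulrC divfK // gt_eqF.
exists x; first by rewrite /x; lra.
move: x1 AxB AxC; move: x => x x1 AxB AxC {BA0 CA0}.
have sx1 : - x <= x * sigma by nra.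
have sx2 : x * sigma <= x by nra.
have xx1 : x <= x ^+ 2 by nra.
have cx : c <= c * x ^+ 2 by nra.
set D := c + _.
have D0 : 0 < D by rewrite /D; lra.
have Dle : D <= (c + 2) * x ^+ 2 by rewrite /D; lra.
have ex0 := expR_gt0 (- x).
have ex1 : expR (- x) <= 1 by rewrite expR_le1; lra.
have exx : x ^+ 2 / 4 <= expR x.
  (* Squaring [1 + x / 2 <= expR (x / 2)] gives the quadratic lower bound. *)
  have -> : expR x = expR (x / 2) ^+ 2 by rewrite -expRM_natl; congr expR; field.
  have := expR_ge1Dx (x / 2); nra.
have -> : expR x * ((A * x - B) / D) - expR (- x) * ((P + Q * x) / D) - T =
   (expR x * (A * x - B) - expR (- x) * (P + Q * x) - T * D) / D.
  by field; rewrite gt_eqF.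
apply: divr_gt0 => //.
have h1 : x ^+ 2 / 4 * (A * x / 2) <= expR x * (A * x - B).
  by apply: ler_pM => //; [nra | nra | lra].
have h2 : expR (- x) * (P + Q * x) <= (P + Q) * x ^+ 2.
  have Px : P <= P * x ^+ 2 by nra.
  have Qx : Q * x <= Q * x ^+ 2 by rewrite ler_wpM2l.
  have PQ0 : 0 <= P + Q * x by rewrite addr_ge0 // mulr_ge0 //; lra.
  by have := ler_wpM2r PQ0 ex1; lra.
have h3 : T * D <= `|T| * ((c + 2) * x ^+ 2).
  by apply: le_trans (ler_wpM2r (ltW D0) T0) _; rewrite ler_wpM2l.
have h4 : 8 * C * x ^+ 2 < A * x * x ^+ 2 by rewrite ltr_pM2r // exprn_gt0; lra.
rewrite /C in h4; lra.
Qed.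

End RealFunctions.

(** * The ray coefficients and the sign of their common denominator *)

Section RootFinding.
Context (R : realType) (dr ds dt : R) (hdr : 0 < dr) (hds : 0 < ds) (hdt : 0 < dt).
Variables r0 s0 t0 : R.

Let den (rho : R) := ds ^+ 2 * dr ^- 2 + rho * (rho - 1).
Let sp := s_p dr ds r0 s0.
Let rd := r_d dr ds r0 s0.
Let h := root_fun dr ds dt r0 s0 t0.
Let A3 := a3 dr ds r0 s0.
Let A4 := a4 dr ds r0 s0.

Let dr0 : dr != 0. Proof. by rewrite gt_eqF. Qed.
Let ds0 : ds != 0. Proof. by rewrite gt_eqF. Qed.
Let dt0 : dt != 0. Proof. by rewrite gt_eqF. Qed.

Let c_gt0 : 0 < ds ^+ 2 * dr ^- 2.
Proof. by rewrite mulr_gt0 ?invr_gt0 ?exprn_gt0. Qed.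

(** Cramer's rule for the two ray coefficients: the determinant of the system is
    [- (dr / ds) * den rho]. *)
Lemma s_p_r_dK rho : den rho != 0 ->
  r0 = dr * rho * sp rho + dr^-1 * rd rho /\
  s0 = ds * sp rho + (1 - rho) * ds^-1 * rd rho.
Proof.
move=> d0.
have d1 : ds ^+ 2 + rho * (rho - 1) * dr ^+ 2 != 0.
  have -> : ds ^+ 2 + rho * (rho - 1) * dr ^+ 2 = den rho * dr ^+ 2.
    by rewrite /den; field.
  by rewrite mulf_neq0 // expf_neq0.
by rewrite /sp /rd /s_p /r_d; split; field; rewrite dr0 d1 ds0.
Qed.

Lemma s_pE rho : r0 != 0 -> sp rho = r0 / dr * ((rho - A4) / den rho).
Proof.
move=> r00; rewrite /sp /s_p mulrA; congr (_ / _).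
by rewrite /A4 /a4; field; rewrite r00 dr0.
Qed.

Lemma r_dE rho : s0 != 0 -> rd rho = ds * s0 * ((A3 - rho) / den rho).
Proof.
move=> s00; rewrite /rd /r_d mulrA; congr (_ / _).
by rewrite /A3 /a3; field; rewrite s00 dr0 ds0.
Qed.

Lemma den_gt0 rho : rho <= 0 \/ 1 <= rho -> 0 < den rho.
Proof. by move=> rho01; rewrite ltr_wpDr //; case: rho01; nra. Qed.

(** Written so that, for [rho > 0] between [A3] and [A4], both summands have the sign of [A3 - A4]
    or vanish; the coefficient of [A3 - rho] is [1 - A4], and its product with [A3] is
    [ds ^+ 2 * dr ^- 2]. *)
Lemma denE rho : r0 != 0 -> s0 != 0 ->
  den rho = (rho - A4) * rho + s0 * ds / (r0 * dr) * (A3 - rho).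
Proof.
by move=> r00 s00; rewrite /den /A3 /A4 /a3 /a4; field; rewrite r00 s00 dr0.
Qed.

Lemma den_gt0_hull rho : 0 < r0 -> 0 < s0 -> A4 < A3 -> A4 <= rho <= A3 ->
  0 < den rho.
Proof.
move=> r0p s0p A43 /andP[h4 h3].
have [rho0|rho0] := leP rho 0; first by apply: den_gt0; left.
rewrite denE ?gt_eqF //.
have q0 : 0 < s0 * ds / (r0 * dr) by rewrite divr_gt0 ?mulr_gt0.
(* At [rho = A3] the first summand is positive, elsewhere the second one is. *)
by move: q0; set q := _ / _ => q0; have [|] := eqVneq rho A3; nra.
Qed.

Lemma den_lt0_hull rho : 0 < r0 -> 0 < s0 -> A3 < A4 -> A3 <= rho <= A4 ->
  den rho < 0.
Proof.
move=> r0p s0p A34 /andP[h3 h4].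
have a30 : 0 < A3 by rewrite /A3 /a3 divr_gt0 ?mulr_gt0.
rewrite denE ?gt_eqF //.
have q0 : 0 < s0 * ds / (r0 * dr) by rewrite divr_gt0 ?mulr_gt0.
by move: q0; set q := _ / _ => q0; have [|] := eqVneq rho A3; nra.
Qed.

Lemma den_neq0_hull rho : 0 < r0 -> 0 < s0 -> A3 != A4 ->
  Num.min A3 A4 <= rho <= Num.max A3 A4 -> den rho != 0.
Proof.
move=> r0p s0p; case: (ltgtP A3 A4) => // A34 _ rhoI.
  by rewrite lt_eqF // den_lt0_hull.
by rewrite gt_eqF // den_gt0_hull.
Qed.

(** This bound and the next keep the half-line intervals outside []0, 1[], where [den_gt0]
    applies. *)
Lemma a3_le0 : r0 <= 0 -> 0 < s0 -> A3 <= 0.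
Proof.
move=> r00 s0p; rewrite /A3 /a3 -[_ / _]mulrA mulr_le0_ge0 //.
by rewrite divr_ge0 ?mulr_ge0 ?ltW.
Qed.

Lemma a4_ge1 : 0 < r0 -> s0 <= 0 -> 1 <= A4.
Proof.
move=> r0p s00; rewrite /A4 /a4 -[_ / _]mulrA lerBrDr gerDl mulr_le0_ge0 //.
by rewrite divr_ge0 ?mulr_ge0 ?ltW.
Qed.

Lemma root_itv_pos rho : ~ (r0 <= 0 /\ s0 <= 0) -> rho \in root_itv dr ds r0 s0 ->
  [/\ den rho != 0, 0 < sp rho & 0 < rd rho].
Proof.
move=> quad; rewrite /root_itv /= -/A3 -/A4.
have [r0p|r0n] := ltP 0 r0; have [s0p|s0n] := ltP 0 s0 => /=; rewrite in_itv /= ?andbT.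
- case: (ltgtP A3 A4) => [A34|A43|->].
  + move=> /andP[h3 h4].
    have d0 : den rho < 0 by rewrite den_lt0_hull // !ltW.
    have quo u : u < 0 -> 0 < u / den rho by move=> u0; rewrite nmulr_rgt0 ?invr_lt0.
    rewrite lt_eqF // s_pE ?r_dE ?gt_eqF //; split=> //.
      by apply: mulr_gt0; [exact: divr_gt0 | rewrite quo // subr_lt0].
    by apply: mulr_gt0; [exact: mulr_gt0 | rewrite quo // subr_lt0].
  + move=> /andP[h4 h3].
    have d0 : 0 < den rho by rewrite den_gt0_hull // !ltW.
    by rewrite gt_eqF // s_pE ?r_dE ?gt_eqF //; split=> //;
      rewrite mulr_gt0 ?mulr_gt0 ?invr_gt0 // subr_gt0.
  + by move=> /andP[/lt_trans H/H]; rewrite ltxx.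
- move=> h4; have A41 := a4_ge1 r0p s0n.
  have d0 : 0 < den rho by apply: den_gt0; right; lra.
  rewrite gt_eqF // s_pE ?gt_eqF //; split=> //.
    by rewrite mulr_gt0 ?divr_gt0 // subr_gt0.
  rewrite /rd /r_d divr_gt0 // mulr_gt0 ?divr_gt0 ?exprn_gt0 //.
  have rho0 : 0 <= rho by lra.
  have : 0 <= ds^-1 * dr * rho * - s0.
    by rewrite !mulr_ge0 ?oppr_ge0 // ?invr_ge0 ltW.
  lra.
- move=> h3; have A30 := a3_le0 r0n s0p.
  have d0 : 0 < den rho by apply: den_gt0; left; lra.
  rewrite gt_eqF // r_dE ?gt_eqF //; split=> //.
    rewrite /sp /s_p divr_gt0 //.
    have : 0 < s0 * dr ^- 2 * ds by rewrite !mulr_gt0 ?invr_gt0 ?exprn_gt0.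
    have rho0 : 0 <= 1 - rho by lra.
    have : 0 <= dr^-1 * - r0 * (1 - rho).
      by rewrite !mulr_ge0 ?oppr_ge0 // invr_ge0 ltW.
    lra.
  by rewrite mulr_gt0 ?mulr_gt0 ?invr_gt0 // subr_gt0.
- by case: quad.
Qed.

(** * Continuity, endpoint signs and roots of [h] *)

Lemma root_fun_continuous rho : den rho != 0 -> {for rho, continuous h}.
Proof.
move=> d0.
have cden : {for rho, continuous den}.
  apply: continuousD; first exact: cst_continuous.
  by apply: continuousM => //; apply: continuousB => //; exact: cst_continuous.
have cexpN : {for rho, continuous (fun x : R => expR (- x))}.
  by apply: continuous_comp; [exact: opp_continuous | exact: continuous_expR].
have cc (c : R) : {for rho, continuous (fun=> c)} by exact: cst_continuous.
have cid : {for rho, continuous (@id R)} by [].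
rewrite /h /root_fun.
apply: continuousB => //; apply: continuousB.
  apply: continuousM; first by apply: continuousM => //; exact: continuous_expR.
  apply: continuousM; last exact: continuousV.
  by apply: continuousB => //; apply: continuousM => //; apply: continuousB.
apply: continuousM; first exact: continuousM.
apply: continuousM; last exact: continuousV.
apply: continuousM => //; apply: continuousB => //.
by apply: continuousM => //; apply: continuousM.
Qed.

(** With [rd A3 = 0] the system gives [sp A3 = s0 / ds], so [h A3] is the height of the boundary of
    the scaled cone over [(r0, s0)], minus [t0]. *)
Lemma root_fun_a3_gt0 : 0 < s0 -> den A3 != 0 ->
  ~ scaled_exp_cone dr ds dt (vec3 r0 s0 t0) -> 0 < h A3.
Proof.
move=> s0p d0; apply: contra_notT; rewrite -leNgt => hle.
have rd0 : rd A3 = 0 by rewrite r_dE ?gt_eqF // subrr mul0r mulr0.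
have [_] := s_p_r_dK d0; rewrite rd0 mulr0 addr0 => sE.
rewrite scaled_exp_coneP // exp_cone_vec3; left; split; first exact: divr_gt0.
have -> : r0 / dr / (s0 / ds) = A3 by rewrite /A3 /a3; field; rewrite dr0 ds0 gt_eqF.
rewrite ler_pdivlMr //; move: hle; rewrite /h /root_fun -/(sp A3) -/(rd A3) rd0.
have -> : s0 / ds = sp A3 by rewrite {1}sE; field.
lra.
Qed.

(** With [sp A4 = 0] the system gives [rd A4 = dr * r0], so [h A4] is the height of the boundary of
    the scaled polar cone over [(r0, s0)], minus [t0]. *)
Lemma root_fun_a4_lt0 : 0 < r0 -> den A4 != 0 ->
  ~ scaled_exp_polar dr ds dt (vec3 r0 s0 t0) -> h A4 < 0.
Proof.
move=> r0p d0; apply: contra_notT; rewrite -leNgt => hge.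
have sp0 : sp A4 = 0 by rewrite s_pE ?gt_eqF // subrr mul0r mulr0.
have [] := s_p_r_dK d0; rewrite sp0 mulr0 add0r => rE _.
rewrite scaled_exp_polarP // exp_cone_dual_vec3; left.
rewrite oppr_lt0 mulr_gt0 //; split=> //.
have -> : - (ds * s0) / - (dr * r0) = 1 - A4 by rewrite /A4 /a4; field; rewrite dr0 gt_eqF.
have rdE : rd A4 = dr * r0 by rewrite rE; field.
move: hge; rewrite /h /root_fun -/(sp A4) -/(rd A4) sp0 rdE (expRD 1 (- A4)) opprK => hge.
rewrite mulrCA ler_pM2l ?expR_gt0 //.
have : dt * (dt^-1 * expR (- A4) * (dr * r0)) <= dt * - t0 by rewrite ler_pM2l //; lra.
by rewrite !mulrA mulfV // mul1r; lra.
Qed.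

Lemma root_exists : ~ scaled_exp_cone dr ds dt (vec3 r0 s0 t0) ->
  ~ scaled_exp_polar dr ds dt (vec3 r0 s0 t0) -> ~ (r0 <= 0 /\ s0 <= 0) ->
  (0 < r0 -> 0 < s0 -> A3 != A4) ->
  exists2 rho, rho \in root_itv dr ds r0 s0 & h rho = 0.
Proof.
move=> nK nP quad neqA; rewrite /root_itv /= -/A3 -/A4.
have [r0p|r0n] := ltP 0 r0; have [s0p|s0n] := ltP 0 s0 => /=.
- have hull := den_neq0_hull r0p s0p (neqA r0p s0p).
  have h4 : h A4 < 0 by apply: root_fun_a4_lt0 => //; apply: hull; rewrite ge_min le_max lexx !orbT.
  have h3 : 0 < h A3 by apply: root_fun_a3_gt0 => //; apply: hull; rewrite ge_min le_max lexx.
  have [x|x xI hx] := IVT_strict _ h4 h3.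
    by rewrite minC maxC => /hull/root_fun_continuous.
  by exists x; rewrite // in_itv /= minC maxC.
- have A41 := a4_ge1 r0p s0n.
  have dpos x : A4 <= x -> den x != 0.
    by move=> xA; rewrite gt_eqF // den_gt0 //; right; lra.
  have h4 : h A4 < 0 by apply: root_fun_a4_lt0 => //; apply: dpos.
  (* The constants are read off [h x] by expanding the numerators of [dt * s_p] and [dt^-1 * r_d] in
     powers of [x]. *)
  have [||||x Ax hx] := @expR_dominates R (ds ^+ 2 * dr ^- 2) (-1) (dt * r0 / dr)
    (dt * (r0 / dr - s0 * ds / dr ^+ 2)) (dt^-1 * ds ^+ 2 / dr * r0)
    (dt^-1 * ds * - s0) t0 A4 c_gt0.
  + by rewrite lexx; lra.
  + by rewrite divr_gt0 ?mulr_gt0.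
  + by rewrite !mulr_ge0 ?invr_ge0 ?exprn_ge0 ?ltW.
  + by rewrite !mulr_ge0 ?oppr_ge0 // ?invr_ge0 ltW.
  have {}hx : 0 < h x.
    move: hx; rewrite -/(den x) /h /root_fun /s_p /r_d -/(den x).
    set y := (X in 0 < X); set z := (X in _ -> 0 < X); suff -> : y = z by [].
    by rewrite /y /z; move: (dpos x (ltW Ax)) => dx; field; rewrite dx dr0 ds0 dt0.
  have [y|y] := IVT_strict _ h4 hx.
    by rewrite (min_idPl (ltW Ax)) => /andP[/dpos/root_fun_continuous].
  by rewrite (min_idPl (ltW Ax)) => /andP[Ay _] hy; exists y; rewrite // in_itv /= Ay.
- have A30 := a3_le0 r0n s0p.
  have dpos x : x <= A3 -> den x != 0.
    by move=> xA; rewrite gt_eqF // den_gt0 //; left; lra.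
  have h3 : 0 < h A3 by apply: root_fun_a3_gt0 => //; apply: dpos.
  (* Applied to [- h (- x)]: the reflection exchanges the roles of [s_p] and [r_d], and [r_d] now
     carries the growing exponential. *)
  have [||||x] := @expR_dominates R (ds ^+ 2 * dr ^- 2) 1 (dt^-1 * ds * s0)
    (- (dt^-1 * ds ^+ 2 / dr * r0)) (dt * (s0 * ds / dr ^+ 2 - r0 / dr))
    (dt * - r0 / dr) (- t0) (- A3) c_gt0.
  + by rewrite lexx andbT; lra.
  + by rewrite !mulr_gt0 ?invr_gt0.
  + by rewrite mulr_ge0 ?(ltW hdt) // subr_ge0 (@le_trans _ _ 0) //
      ?divr_ge0 ?pmulr_lle0 ?mulr_ge0 ?exprn_ge0 ?invr_gt0 // ltW.
  + by rewrite !mulr_ge0 ?oppr_ge0 // ?invr_ge0 ltW.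
  rewrite ltrNl => Ax hx.
  have {}hx : h (- x) < 0.
    rewrite -oppr_gt0; move: hx; have -> : ds ^+ 2 * dr ^- 2 + x * (x + 1) = den (- x).
      by rewrite /den; ring.
    rewrite /h /root_fun /s_p /r_d -/(den (- x)) !opprK.
    set y := (X in 0 < X); set z := (X in _ -> 0 < X); suff -> : y = z by [].
    by rewrite /y /z; move: (dpos (- x) (ltW Ax)) => dx; field; rewrite dx dr0 ds0 dt0.
  have [y|y] := IVT_strict _ hx h3.
    by rewrite (max_idPr (ltW Ax)) => /andP[_ /dpos/root_fun_continuous].
  by rewrite (max_idPr (ltW Ax)) => /andP[_ Ay] hy; exists y; rewrite // in_itv /= Ay.
- by case: quad.
Qed.

(** * Explicit solutions in each case, and existence *)

Lemma root_moreau rho : ~ (r0 <= 0 /\ s0 <= 0) ->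
  rho \in root_itv dr ds r0 s0 -> h rho = 0 ->
  moreau_system dr ds dt (vec3 r0 s0 t0)
    (sp rho *: vec3 (dr * rho) ds (dt * expR rho))
    (rd rho *: vec3 dr^-1 ((1 - rho) * ds^-1) (- dt^-1 * expR (- rho))).
Proof.
move=> quad /(root_itv_pos quad)[d0 sp0 rd0] hrho.
have [rE sE] := s_p_r_dK d0.
by apply: moreau_rays => //; apply/esym/subr0_eq.
Qed.

(* When the bracket degenerates, the two rays attached to [rho = a3 = a4] project
   to the line of [(r0, s0)], and the share carried by each is fixed by [t0]. *)
Lemma moreau_degenerate : ~ scaled_exp_cone dr ds dt (vec3 r0 s0 t0) ->
  ~ scaled_exp_polar dr ds dt (vec3 r0 s0 t0) -> 0 < r0 -> 0 < s0 -> A3 = A4 ->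
  exists p d, moreau_system dr ds dt (vec3 r0 s0 t0) p d.
Proof.
move=> nK nP r0p s0p eA.
have [r00 s00] : r0 != 0 /\ s0 != 0 by rewrite !gt_eqF.
(* Over [(r0, s0)] the scaled cone begins at height [U] and the scaled polar cone ends at height
   [- V], so [t0] lies strictly between [- V] and [U]. *)
pose U := dt * expR A3 * (s0 / ds); pose V := dt^-1 * expR (- A3) * (r0 * dr).
have UK : t0 < U.
  rewrite ltNge; apply: contra_notN nK => le_t0.
  rewrite scaled_exp_coneP // exp_cone_vec3; left; split; first exact: divr_gt0.
  have -> : r0 / dr / (s0 / ds) = A3 by rewrite /A3 /a3; field; rewrite dr0 ds0 s00.
  by rewrite ler_pdivlMr //; move: le_t0; rewrite /U; lra.
have VP : - V < t0.
  rewrite ltNge; apply: contra_notN nP => le_t0.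
  rewrite scaled_exp_polarP // exp_cone_dual_vec3; left.
  rewrite oppr_lt0 mulr_gt0 //; split=> //.
  have -> : - (ds * s0) / - (dr * r0) = 1 - A3.
    by rewrite eA /A4 /a4; field; rewrite dr0 r00.
  rewrite (expRD 1 (- A3)) opprK mulrCA ler_pM2l ?expR_gt0 //.
  have : dt * V <= dt * - t0 by rewrite ler_pM2l //; lra.
  by rewrite /V !mulrA mulfV // mul1r; lra.
have UV : 0 < U + V by lra.
(* The weight solving [lam * U - (1 - lam) * V = t0]. *)
pose lam := (t0 + V) / (U + V).
have lam0 : 0 < lam by rewrite divr_gt0 //; lra.
have lam1 : 0 < 1 - lam by rewrite subr_gt0 ltr_pdivrMr // mul1r; lra.
exists (lam * (s0 / ds) *: vec3 (dr * A3) ds (dt * expR A3)).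
exists ((1 - lam) * (r0 * dr) *:
  vec3 dr^-1 ((1 - A3) * ds^-1) (- dt^-1 * expR (- A3))).
apply: moreau_rays => //; first by rewrite mulr_gt0 // divr_gt0.
- by rewrite !mulr_gt0.
(* The first coordinate closes with the formula of [a3], the second with that of [a4]. *)
- by rewrite /A3 /a3; field; rewrite dr0 ds0 s00.
- by rewrite eA /A4 /a4; field; rewrite dr0 ds0 r00.
- transitivity (lam * U - (1 - lam) * V); last by rewrite /U /V; ring.
  by rewrite /lam; field; rewrite gt_eqF.
Qed.

Lemma moreau_in_cone (v : 'cV[R]_3) : scaled_exp_cone dr ds dt v ->
  moreau_system dr ds dt v v 0.
Proof.
move=> Kv; split; rewrite ?addr0 //.
  rewrite -(vec30 R) scaled_exp_polarP // exp_cone_dual_vec3; right.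
  by rewrite !mulr0 oppr0.
by rewrite (vec3K v) -(vec30 R) dotv_vec3 !mulr0 !addr0.
Qed.

Lemma moreau_in_polar (v : 'cV[R]_3) : scaled_exp_polar dr ds dt v ->
  moreau_system dr ds dt v 0 v.
Proof.
move=> Kv; split; rewrite ?add0r //.
  by rewrite -(vec30 R) scaled_exp_coneP // exp_cone_vec3; right; rewrite !mul0r.
by rewrite (vec3K v) -(vec30 R) dotv_vec3 !mul0r !addr0.
Qed.

Lemma moreau_quadrant : r0 <= 0 -> s0 <= 0 ->
  moreau_system dr ds dt (vec3 r0 s0 t0)
    (vec3 r0 0 (posr t0)) (vec3 0 s0 (- negr t0)).
Proof.
move=> r0n s0n; rewrite /posr /negr opprK; split.
- rewrite vec3D addr0 add0r; congr vec3.
  by rewrite addr_max_min addr0.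
- rewrite scaled_exp_coneP // exp_cone_vec3; right; rewrite mul0r; split=> //.
    by rewrite divr_ge0 ?(ltW hdt) // le_max lexx orbT.
  by rewrite pmulr_lle0 ?invr_gt0.
- rewrite scaled_exp_polarP // exp_cone_dual_vec3; right; rewrite mulr0 oppr0.
  by split; rewrite // oppr_ge0 pmulr_rle0 // ge_min lexx orbT.
- rewrite dotv_vec3 mulr0 mul0r !add0r.
  by case: (ltP t0 0) => _; rewrite ?mulr0 ?mul0r.
Qed.

(** Follows the case distinction of the algorithm, with one extra case: for [r0, s0 > 0] and
    [A3 = A4] the bracket is empty, and the explicit combination replaces the root. *)
Lemma moreau_exists : exists p d, moreau_system dr ds dt (vec3 r0 s0 t0) p d.
Proof.
have [/moreau_in_cone|nK] := pselect (scaled_exp_cone dr ds dt (vec3 r0 s0 t0)).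
  by exists (vec3 r0 s0 t0), 0.
have [/moreau_in_polar|nP] := pselect (scaled_exp_polar dr ds dt (vec3 r0 s0 t0)).
  by exists 0, (vec3 r0 s0 t0).
have [[r0n s0n]|quad] := pselect (r0 <= 0 /\ s0 <= 0).
  by eexists; eexists; exact: moreau_quadrant.
have [[r0p s0p eA]|neqA] := pselect [/\ 0 < r0, 0 < s0 & A3 = A4].
  exact: moreau_degenerate.
have [|rho rhoI hrho] := root_exists nK nP quad.
  by move=> r0p s0p; apply/eqP => eA; apply: neqA.
by eexists; eexists; exact: root_moreau quad rhoI hrho.
Qed.

End RootFinding.

(** By uniqueness, each case only requires exhibiting one solution of the system. Existence of a
    root is stated for a nonempty interval, since the open bracket is empty when [a3] and [a4]
    coincide. *)
Theorem theorem3 (R : realType) (dr ds dt : R)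
    (hdr : 0 < dr) (hds : 0 < ds) (hdt : 0 < dt) (r0 s0 t0 : R) :
  let v0 := vec3 r0 s0 t0 in
  (exists! v : 'cV[R]_3 * 'cV[R]_3, moreau_system dr ds dt v0 v.1 v.2) /\
  forall vp vd : 'cV[R]_3, moreau_system dr ds dt v0 vp vd ->
  [/\ scaled_exp_cone dr ds dt v0 -> vp = v0 /\ vd = 0,
      scaled_exp_polar dr ds dt v0 -> vp = 0 /\ vd = v0,
      r0 <= 0 /\ s0 <= 0 ->
        vp = vec3 r0 0 (posr t0) /\ vd = vec3 0 s0 (- negr t0)
    & ~ scaled_exp_cone dr ds dt v0 ->
      ~ scaled_exp_polar dr ds dt v0 ->
      ~ (r0 <= 0 /\ s0 <= 0) ->
      let I := root_itv dr ds r0 s0 in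
      let h := root_fun dr ds dt r0 s0 t0 in
      ([set` I] !=set0 -> exists2 rho : R, rho \in I & h rho = 0) /\
      (forall rho : R, rho \in I -> h rho = 0 ->
         vp = s_p dr ds r0 s0 rho *: vec3 (dr * rho) ds (dt * expR rho) /\
         vd = r_d dr ds r0 s0 rho *:
                vec3 dr^-1 ((1 - rho) * ds^-1) (- dt^-1 * expR (- rho)))].
Proof.
split.
  have [p [d pd]] := moreau_exists hdr hds hdt r0 s0 t0.
  exists (p, d); split=> //= -[p' d'] /= pd'.
  by have [-> ->] := moreau_uniq hdr hds hdt pd pd'.
move=> vp vd pd; have uniq := moreau_uniq hdr hds hdt pd; split.
- by move=> /(moreau_in_cone hdr hds hdt)/uniq.
- by move=> /(moreau_in_polar hdr hds hdt)/uniq.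
- by move=> [r0n s0n]; apply: uniq; exact: moreau_quadrant.
move=> nK nP quad /=; split=> [[rho /= rhoI]|rho rhoI hrho].
  apply: (root_exists hdr hds hdt nK nP quad) => r0p s0p; apply: contraTneq rhoI => eA.
  rewrite /root_itv r0p s0p /= in_itv /= eA minxx maxxx.
  by apply/negP => /andP[/lt_trans H/H]; rewrite ltxx.
by apply: uniq; exact: root_moreau.
Qed.
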